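(* If $G$ is a finite transitive permutation group of degree $n>1$, then $|G:D(G)|$ divides $n-1$. Moreover, for an integer $n>1$, there exists a transitive permutation group $G$ of degree $n$ with $|G:D(G)|=n-1$ if and only if $n$ is a prime power.
   Context: For a finite permutation group $G$, $D(G)$ denotes the subgroup of $G$ generated by the derangements in $G$, i.e. the elements of $G$ with no fixed points. The degree is the number of points acted on. *)

(* Defs.v *)
From mathcomp Require Import all_boot all_fingroup.

Set Implicit Arguments.
Unset Strict Implicit.
Unset Printing Implicit Defensive.

Local Open Scope group_scope.

Section DerangementSubgroup.

Variable T : finType.

Definition derangement (g : {perm T}) : bool := [forall x, g x != x].

Definition derangement_subgroup (G : {set {perm T}}) : {group {perm T}} :=
  <<[set g in G | derangement g]>>%G.

Definition transitive_perm_group (G : {set {perm T}}) : bool :=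
  [transitive G, on [set: T] | 'P].

End DerangementSubgroup.

Definition prime_power (n : nat) : Prop :=
  exists p k : nat, [/\ prime p, 0 < k & n = (p ^ k)%N].

(* Main.v *)
Require Import Defs.
From mathcomp Require Import all_boot all_fingroup.
From mathcomp Require Import ssralg finalg finfield pgroup.

(** Let [D] be the subgroup generated by the derangements of the transitive
    group [G].  By orbit counting the elements of [G] fix one point on average,
    those of [D] at least one; as every element outside [D] fixes at least one
    point, [D] is transitive and every element outside [D] fixes exactly one
    point.  So in the stabiliser [G_x] all two-point stabilisers lie in
    [D_x], every [G_x]-orbit other than [{x}] has length divisible by
    [|G_x : D_x| = |G : D|], and these lengths add up to [n - 1].

    If [|G : D| = n - 1], there is a single such orbit and [D_x = G_xy] for all
    [y <> x], so [D_x = 1]: [D] is regular, and the transitive action of [G_x]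
    on the other points is its conjugation action on [D \ 1].  All nontrivial
    elements of [D] are thus conjugate, and [n = |D|] has a single prime
    divisor.  Conversely, in the affine group [x |-> a x + b] of a finite field
    the derangements are translations. *)

Set Implicit Arguments.
Unset Strict Implicit.
Unset Printing Implicit Defensive.

Local Open Scope group_scope.

#[local] Arguments derangement_subgroup : simpl never.

(** * Orbit counting and the divisibility bound *)

Section TransitiveGroup.

Variables (T : finType) (G : {group {perm T}}).

Local Notation D := (derangement_subgroup G).

Lemma derangement_subgroup_sub : D \subset G.
Proof. by rewrite gen_subG; apply/subsetP => g; rewrite inE => /andP[]. Qed.

Lemma derangementJ (g h : {perm T}) : derangement g -> derangement (g ^ h).
Proof.
move=> /forallP dg; apply/forallP => x; rewrite -[x](permKV h) permJ.
by rewrite (inj_eq perm_inj) dg.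
Qed.

Lemma derangement_subgroup_normal : D <| G.
Proof.
rewrite /(_ <| _) derangement_subgroup_sub norms_gen //.
apply/normsP => h Gh; apply/eqP; rewrite eqEcard cardJg leqnn andbT.
apply/subsetP => _ /imsetP[g /[!inE] /andP[Gg dg] ->].
by rewrite groupJ //= derangementJ.
Qed.

Lemma fix_gt0_notin_derangement_subgroup g :
  g \in G :\: D -> 0 < #|'Fix_'P[g]|.
Proof.
case/setDP=> Gg; apply: contraNltn; rewrite leqn0 cards_eq0 => /eqP fix0.
apply: mem_gen; rewrite inE Gg; apply/forallP => x.
apply/negP => /eqP gx; have: x \in 'Fix_'P[g] by apply/afix1P.
by rewrite fix0 inE.
Qed.

Hypotheses (T_gt0 : 0 < #|T|) (trG : transitive_perm_group G).

Lemma sum_fix_eq (H : {group {perm T}}) :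
  (\sum_(g in H) #|'Fix_'P[g]| = #|orbit 'P H @: [set: T]| * #|H|)%N.
Proof.
rewrite -Frobenius_Cauchy; last by apply/actsP => g _ x; rewrite !inE.
by apply: eq_bigr => g _; rewrite setTI.
Qed.

Lemma derangement_subgroup_count :
  #|orbit 'P D @: [set: T]| = 1%N /\
  forall g, g \in G :\: D -> #|'Fix_'P[g]| = 1%N.
Proof.
have [x _] := card_gt0P T_gt0.
have orbD_gt0 : 0 < #|orbit 'P D @: [set: T]|.
  by apply/card_gt0P; exists (orbit 'P D x); apply: imset_f; rewrite inE.
have orbG : #|orbit 'P G @: [set: T]| = 1%N.
  rewrite [orbit 'P G @: _](_ : _ = [set [set: T]]) ?cards1 //.
  apply/setP => S; rewrite inE; apply/imsetP/eqP => [[y _ ->]|->].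
    by apply: (atransP trG); rewrite inE.
  by exists x => //; symmetry; apply: (atransP trG); rewrite inE.
have := sum_fix_eq G; rewrite orbG mul1n (big_setID D) /=.
rewrite (setIidPr derangement_subgroup_sub) sum_fix_eq -(cardsID D G).
rewrite (setIidPr derangement_subgroup_sub) => sumE.
(* The equality case is recorded too: once the count forces equality, every element outside [D] has
   at most one fixed point. *)
have leifE : \sum_(g in G :\: D) 1 <= \sum_(g in G :\: D) #|'Fix_'P[g]|
    ?= iff [forall (g | g \in G :\: D), #|'Fix_'P[g]| <= 1].
  apply: leqif_sum => g /fix_gt0_notin_derangement_subgroup fix_g.
  exact: leqif_geq.
have D_gt0 := cardG_gt0 D.
have := leifE.1; rewrite sum1_card => leGD.
(* The elements outside [D] already contribute [|G| - |D|] to a total of [|G|], which leaves room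
   for only one orbit of [D]. *)
have orb1 : #|orbit 'P D @: [set: T]| = 1%N.
  apply/eqP; rewrite eqn_leq orbD_gt0 andbT -(leq_pmul2r D_gt0) mul1n.
  by rewrite -(leq_add2r (\sum_(g in G :\: D) #|'Fix_'P[g]|)) sumE leq_add2l.
split=> // g Gg; have := leifE.2; rewrite sum1_card.
move: sumE; rewrite orb1 mul1n => /addnI ->; rewrite eqxx.
move/esym/forall_inP/(_ g Gg) => fix_le1; apply/eqP.
by rewrite eqn_leq fix_le1 fix_gt0_notin_derangement_subgroup.
Qed.

Lemma derangement_subgroup_trans : [transitive D, on [set: T] | 'P].
Proof.
have [x _] := card_gt0P T_gt0.
have [/eqP/cards1P[S orbS] _] := derangement_subgroup_count.
have orbE y : orbit 'P D y = S.
  by apply/set1P; rewrite -orbS; apply: imset_f; rewrite inE.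
apply/imsetP; exists x => //; apply/setP => y; rewrite inE orbE -(orbE y).
by rewrite orbit_refl.
Qed.

Lemma two_point_stab_sub x y : x != y -> 'C_G[x | 'P] :&: 'C[y | 'P] \subset D.
Proof.
move=> neq_xy; apply/subsetP => g /setIP[/setIP[Gg /astab1P gx] /astab1P gy].
apply: contraT => Dg.
have /eqP/cards1P[z fixz] : #|'Fix_'P[g]| = 1%N.
  by apply: derangement_subgroup_count.2; apply/setDP.
have fz u : 'P%act u g = u -> u = z by move/afix1P; rewrite fixz => /set1P.
by rewrite (fz x gx) (fz y gy) eqxx in neq_xy.
Qed.

(** [G] and [D] are both transitive, so each stabiliser has index [#|T|] in its group, and the
    quotient of the orders is unchanged. *)
Lemma index_derangement_subgroup_stab x :
  #|'C_G[x | 'P] : 'C_D[x | 'P]| = #|G : D|.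
Proof.
have cardT (H : {group {perm T}}) : [transitive H, on [set: T] | 'P] ->
    (#|T| * #|'C_H[x | 'P]| = #|H|)%N.
  by move=> trH; rewrite -(card_orbit_stab 'P H x) (atransP trH) ?inE ?cardsT.
have GxT := cardT _ trG; have DxT := cardT _ derangement_subgroup_trans.
have sDxGx : 'C_D[x | 'P] \subset 'C_G[x | 'P].
  by rewrite setSI ?derangement_subgroup_sub.
have LGx := Lagrange sDxGx; have LG := Lagrange derangement_subgroup_sub.
have D_gt0 := cardG_gt0 D.
apply/eqP; rewrite -(eqn_pmul2l D_gt0) LG -GxT -LGx -DxT mulnA; exact/eqP.
Qed.

(** The orbit length is the index of [G_xy] in [G_x], and [D_x] lies between these two groups. *)
Lemma index_dvd_orbit x y : x != y -> #|G : D| %| #|orbit 'P 'C_G[x | 'P] y|.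
Proof.
move=> neq_xy; rewrite card_orbit -(index_derangement_subgroup_stab x).
apply: indexgS.
rewrite subsetI (subset_trans (two_point_stab_sub neq_xy)) //=.
by rewrite subIset // subsetIr.
Qed.

Lemma acts_stab_setC1 x : [acts 'C_G[x | 'P], on [set~ x] | 'P].
Proof.
apply/actsP => g /setIP[_ /astab1P gx] y; rewrite !inE.
by rewrite -{1}gx (inj_eq (act_inj 'P g)).
Qed.

Lemma index_derangement_subgroup_dvd : #|G : D| %| #|T|.-1.
Proof.
have [x _] := card_gt0P T_gt0.
rewrite -(cardsC1 x) -(acts_sum_card_orbit (acts_stab_setC1 x)).
apply: dvdn_sum => _ /imsetP[y /[!inE] neq_yx ->].
by rewrite index_dvd_orbit // eq_sym.
Qed.

(** * The extremal case: prime power degree *)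

Section Extremal.

Hypotheses (T_gt1 : 1 < #|T|) (indexD : #|G : D| = #|T|.-1).

Lemma extremal_stab_orbit x y : x != y -> orbit 'P 'C_G[x | 'P] y = [set~ x].
Proof.
move=> neq_xy; apply/eqP; rewrite eqEcard cardsC1 -indexD.
rewrite acts_sub_orbit ?acts_stab_setC1 // !inE eq_sym neq_xy /=.
apply: dvdn_leq; last exact: index_dvd_orbit.
by apply/card_gt0P; exists y; apply: orbit_refl.
Qed.

Lemma extremal_stab1 x : 'C_D[x | 'P] = 1.
Proof.
apply/trivgP/subsetP => g Dxg; have /setIP[_ /astab1P gx] := Dxg.
apply/set1P/permP => y; rewrite perm1; have [<- //|neq_xy] := eqVneq x y.
(* Both groups have index [#|T|.-1] in [G_x], so the inclusion of [G_xy] in [D_x] is an equality and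
   [g] fixes [y]. *)
suff /eqP eqC : 'C_G[x | 'P] :&: 'C[y | 'P] == 'C_D[x | 'P].
  by have /setIP[_ /astab1P] : g \in 'C_G[x | 'P] :&: 'C[y | 'P] by rewrite eqC.
have sCD : 'C_G[x | 'P] :&: 'C[y | 'P] \subset 'C_D[x | 'P].
  rewrite subsetI two_point_stab_sub //=.
  by rewrite subIset // subsetIr.
have sDG : 'C_D[x | 'P] \subset 'C_G[x | 'P].
  by rewrite setSI ?derangement_subgroup_sub.
have := card_orbit_stab 'P 'C_G[x | 'P] y.
rewrite extremal_stab_orbit // cardsC1 -indexD -(index_derangement_subgroup_stab x).
rewrite -(Lagrange sDG) mulnC => /eqP; rewrite eqn_pmul2r ?indexg_gt0 // => /eqP eqc.
by rewrite eqEcard sCD eqc leqnn.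
Qed.

Lemma extremal_card : #|D| = #|T|.
Proof.
have [x _] := card_gt0P T_gt0.
rewrite -(card_orbit_stab 'P D x) extremal_stab1 cards1 muln1.
by rewrite (atransP derangement_subgroup_trans) ?inE ?cardsT.
Qed.

(** Some [k] in [G_x] sends [g x] to [h x]. Then [g ^ k] and [h] agree at [x], and an element of the
    regular group [D] is determined by its value at [x]. *)
Lemma extremal_conj g h :
  g \in D^# -> h \in D^# -> exists2 k, k \in G & h = g ^ k.
Proof.
have [x _] := card_gt0P T_gt0.
have stab1 u : u \in D -> u x = x -> u = 1.
  move=> Du ux; have : u \in 'C_D[x | 'P] by rewrite inE Du; apply/astab1P.
  by rewrite extremal_stab1 => /set1P.
have moved u : u \in D^# -> x != u x.
  by case/setD1P => u1 Du; apply: contraNneq u1 => /esym/stab1->.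
move=> Dg Dh; have : h x \in orbit 'P 'C_G[x | 'P] (g x).
  by rewrite extremal_stab_orbit ?moved // !inE eq_sym moved.
case/orbitP=> k /setIP[Gk /astab1P kx] /= gk; exists k => //.
have [_ Dg'] := setD1P Dg; have [_ Dh'] := setD1P Dh.
have Dgk : g ^ k \in D.
  by rewrite memJ_norm // (subsetP (normal_norm derangement_subgroup_normal)).
apply/esym/eqP; rewrite eq_mulgV1; apply/eqP/stab1.
  by rewrite groupM ?groupV.
move: kx gk; rewrite /= !apermE => kx gk.
by rewrite permM -{1}kx permJ gk permK.
Qed.

Lemma extremal_prime_power : prime_power #|T|.
Proof.
have pr_p := pdiv_prime T_gt1; set p := pdiv _ in pr_p.
have nontriv (q : nat) (u : {perm T}) : prime q -> u \in D -> #[u] = q -> u \in D^#.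
  by move=> pr_q Du ou; rewrite !inE Du andbT -order_gt1 ou prime_gt1.
have [|g Dg og] := Cauchy (G := D) pr_p; first by rewrite extremal_card pdiv_dvd.
have : p.-nat #|T|.
  (* Elements of [D] of orders [p] and [q] are conjugate, so [q = p]. *)
  apply/pnatP => // q pr_q; rewrite -extremal_card => /(Cauchy pr_q)[h Dh oh].
  have [k _ hk] := extremal_conj (nontriv _ _ pr_p Dg og) (nontriv _ _ pr_q Dh oh).
  by rewrite inE /= -oh hk orderJ og.
case/p_natP => k Tpk; exists p, k; split=> //.
by move: T_gt1; rewrite Tpk; case: (k).
Qed.

End Extremal.

End TransitiveGroup.

(** * The affine group of a finite field *)

Section AffineGroup.

Import GRing.Theory.
Local Open Scope ring_scope.

Variable F : finFieldType.

Definition affine_fun (u : {unit F} * F) (x : F) : F := val u.1 * x + u.2.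

Lemma affine_fun_inj u : injective (affine_fun u).
Proof. by move=> x y /addIr/(mulrI (valP u.1)). Qed.

Definition affine_perm u : {perm F} := perm (@affine_fun_inj u).

Lemma affine_permE u x : affine_perm u x = val u.1 * x + u.2.
Proof. by rewrite permE. Qed.

(** Permutations compose from left to right, so [u] is applied first. *)
Lemma affine_permM u v :
  (affine_perm u * affine_perm v)%g =
    affine_perm ((v.1 * u.1)%g, val v.1 * u.2 + v.2).
Proof.
by apply/permP => x; rewrite permM !affine_permE /= mulrDr mulrA addrA.
Qed.

(** The values at 0 and 1 recover the translation part and then the slope. *)
Lemma affine_perm_inj : injective affine_perm.
Proof.
move=> [a b] [c d] /permP eq_ac.
have := eq_ac 0; rewrite !affine_permE !mulr0 !add0r /= => eq_bd.
by have := eq_ac 1; rewrite !affine_permE !mulr1 /= eq_bd => /addIr/val_inj->.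
Qed.

Lemma affine_perm1 : affine_perm (1%g, 0) = 1%g.
Proof. by apply/permP => x; rewrite affine_permE perm1 /= mul1r addr0. Qed.

Definition affine_set := [set affine_perm u | u : {unit F} * F].

Lemma affine_group_set : group_set affine_set.
Proof.
apply/group_setP; split; first by rewrite -affine_perm1; apply: imset_f.
by move=> _ _ /imsetP[u _ ->] /imsetP[v _ ->]; rewrite affine_permM; apply: imset_f.
Qed.

Canonical affine_group := Group affine_group_set.

Definition translation_set := [set affine_perm (1%g, b) | b : F].

Lemma translation_group_set : group_set translation_set.
Proof.
apply/group_setP; split; first by rewrite -affine_perm1; apply: imset_f.
move=> _ _ /imsetP[b _ ->] /imsetP[d _ ->].
by rewrite affine_permM mulg1; apply: imset_f.
Qed.

Canonical translation_group := Group translation_group_set.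

Lemma card_affine_group : #|affine_group| = (#|F|.-1 * #|F|)%N.
Proof.
rewrite card_imset; last exact: affine_perm_inj.
by rewrite card_prod -cardsT card_finField_unit.
Qed.

Lemma card_translation_group : #|translation_group| = #|F|.
Proof. by rewrite card_imset // => b d /affine_perm_inj[]. Qed.

Lemma translation_sub_affine : translation_group \subset affine_group.
Proof. by apply/subsetP => _ /imsetP[b _ ->]; rewrite imset_f. Qed.

Lemma affine_group_trans : transitive_perm_group affine_group.
Proof.
apply/imsetP; exists 0 => //; apply/esym/setP => y; rewrite inE.
apply/orbitP; exists (affine_perm (1%g, y)); first by apply: imset_f.
by rewrite /= apermE affine_permE mulr0 add0r.
Qed.

Lemma affine_derangement_translation :
  derangement_subgroup affine_group \subset translation_group.
Proof.
rewrite gen_subG; apply/subsetP => g /[!inE] /andP[/imsetP[[a b] _ ->] /forallP der].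
have [->|a1] := eqVneq a 1%g; first by apply: imset_f.
have a1' : 1 - val a != 0.
  by rewrite subr_eq0 eq_sym; apply: contraNneq a1 => a1; apply/eqP/val_inj.
(* [b / (1 - a)] is a fixed point of [x |-> a x + b]. *)
case/negP: (der (b / (1 - val a))); rewrite affine_permE /=.
rewrite eq_sym -subr_eq0 opprD addrA -{1}[b / _]mul1r -mulrBl.
by rewrite mulrCA divff // mulr1 subrr.
Qed.

(** One divisibility is the general bound. The other holds because [D] lies in the translation
    group, whose index is [#|F|.-1]. *)
Lemma index_affine_derangement :
  #|affine_group : derangement_subgroup affine_group| = #|F|.-1.
Proof.
have F_gt0 : 0 < #|F| by apply/card_gt0P; exists 0.
apply/eqP; rewrite eqn_dvd index_derangement_subgroup_dvd ?affine_group_trans //=.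
suff <- : #|affine_group : translation_group| = #|F|.-1.
  exact: indexgS affine_derangement_translation.
rewrite -divgS ?translation_sub_affine // card_affine_group card_translation_group.
exact: mulnK.
Qed.

End AffineGroup.

Theorem corollary1p2 :
  (forall (n : nat) (T : finType) (G : {group {perm T}}),
     1 < n -> #|T| = n -> transitive_perm_group G ->
     #|G : derangement_subgroup G|%g %| n - 1)
  /\
  (forall n : nat, 1 < n ->
     ((exists (T : finType) (G : {group {perm T}}),
         [/\ #|T| = n, transitive_perm_group G
           & #|G : derangement_subgroup G|%g = n - 1])
      <-> prime_power n)).
Proof.
split=> [n T G n_gt1 cardT trG | n n_gt1].
  by rewrite subn1 -cardT index_derangement_subgroup_dvd // cardT ltnW.
split=> [[T [G [cardT trG indexG]]] | [p [k [pr_p k_gt0 ->]]]].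
  rewrite -cardT; apply: (extremal_prime_power (G := G)); rewrite ?cardT //.
    exact: ltnW.
  by rewrite -subn1.
have [F _ <-] := pPrimePowerField pr_p k_gt0.
exists F, (affine_group F); split=> //; first exact: affine_group_trans.
by rewrite index_affine_derangement subn1.
Qed.
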